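(* Let $G=(V,E)$ be a finite simple undirected graph, and let $G^c$ denote its complement (same vertex set, edges are the unordered pairs of distinct vertices not in $E$). Suppose $G$ satisfies: (P2) for every edge $e\in E$ there exists a unique triangle (3-cycle) $\Delta$ in $G$ with $e\in\Delta$; (P3) for every non-edge $e\in E^c$ (i.e. every edge of $G^c$) there exists a unique quadrilateral (4-cycle) $\Box$ in $G^c$ with $e\in\Box$. Then $|V|=5$ or $|V|=3$; that is, $G$ is either a triangle or two triangles intersecting in a single vertex.
   Context: A triangle is a cycle of length 3 and a quadrilateral is a cycle of length 4, each regarded as a subgraph (set of edges); uniqueness refers to these cycles as subgraphs.
   Formalization: The formal theorem additionally assumes that G has at least two vertices, since the empty graph and the one-vertex graph satisfy (P2) and (P3) vacuously but have neither 3 nor 5 vertices. *)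

(* Defs.v *)
From mathcomp Require Import all_boot.

Set Implicit Arguments.
Unset Strict Implicit.
Unset Printing Implicit Defensive.

(* A finite simple graph on the vertex type T is a symmetric irreflexive
   relation g : rel T; an undirected edge is a two-element set [set x; y]. *)

Definition graph_compl (T : finType) (g : rel T) : rel T :=
  [rel x y | (x != y) && ~~ g x y].

Definition edges (T : finType) (g : rel T) : {set {set T}} :=
  [set A | [exists x, exists y, g x y && (A == [set x; y])]].

(* The undirected edges of the closed walk through the items of c. *)
Definition cycle_edges (T : finType) (c : seq T) : {set {set T}} :=
  [set [set x; next c x] | x in c].

(* C is the edge set of a k-cycle of g. The existential identifies all
   rotations and reversals of c, so that distinct C are distinct subgraphs.
   Only meaningful for 3 <= k. *)
Definition is_cycle (T : finType) (g : rel T) (k : nat) (C : {set {set T}})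
    : Prop :=
  exists c : seq T, [/\ size c = k, ucycle g c & C = cycle_edges c].

Notation is_triangle g C := (is_cycle g 3 C).
Notation is_quadrilateral g C := (is_cycle g 4 C).

(* In the next two definitions cover C is the vertex set of the cycle C; the
   cover condition excludes isolated vertices. *)
Definition is_triangle_graph (T : finType) (g : rel T) : Prop :=
  exists C, [/\ is_triangle g C, edges g = C & cover C = [set: T]].

Definition is_two_triangles_at_vertex (T : finType) (g : rel T) : Prop :=
  exists C1 C2,
    [/\ is_triangle g C1, is_triangle g C2, edges g = C1 :|: C2,
        cover C1 :|: cover C2 = [set: T] &
        exists v, cover C1 :&: cover C2 = [set v]].

(* Main.v *)
(* By (P2), every neighbourhood in G is a perfect matching, so the neighbours
   of a, b, c outside a triangle abc form disjoint sets A, B, C that are unions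
   of disjoint edges. By (P3), the complement contains no K_{2,3}. If a vertex r
   is adjacent to none of a, b, c, then A, B, C are empty, since two vertices of
   A and r would be common non-neighbours of b and c; the quadrilateral through
   the non-edge ar then gives another such vertex w, and a, b, c are common
   non-neighbours of r and w. So abc is dominating, and each of A, B, C has at
   most two elements. If two of them are nonempty, two quadrilaterals of the
   complement share an edge; otherwise |V| is 3 or 5. *)
Require Import Defs.
From mathcomp Require Import all_boot.

Set Implicit Arguments.
Unset Strict Implicit.
Unset Printing Implicit Defensive.

(** * Short cycles as explicit sets of edges *)

Lemma eq_set2P (T : finType) (x y p q : T) :
  [set x; y] = [set p; q] -> (x = p /\ y = q) \/ (x = q /\ y = p).
Proof.
move=> E.
have: x \in [set p; q] by rewrite -E set21.
have: y \in [set p; q] by rewrite -E set22.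
have: p \in [set x; y] by rewrite E set21.
have: q \in [set x; y] by rewrite E set22.
rewrite !inE.
by do 4 (case/orP => /eqP ?); subst; auto.
Qed.

Lemma cycle_edges3 (T : finType) (a b c : T) : uniq [:: a; b; c] ->
  cycle_edges [:: a; b; c] = [set [set a; b]; [set b; c]; [set c; a]].
Proof.
rewrite /= !inE !negb_or andbT => /andP[/andP[ab ac] bc].
have [ba ca cb] : [/\ (b == a) = false, (c == a) = false & (c == b) = false].
  by rewrite ![_ == a]eq_sym [c == b]eq_sym !(negbTE ab, negbTE ac, negbTE bc).
apply/setP => e; apply/imsetP/idP.
- case=> x; rewrite !inE => /or3P[] /eqP -> ->;
    by rewrite /= ?(eqxx, ba, ca, cb, negbTE ab, negbTE bc, negbTE ac) ?orbT.
- rewrite !inE -orbA => /or3P[] /eqP ->; [exists a|exists b|exists c];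
    by rewrite ?inE /= ?(eqxx, ba, ca, cb, negbTE ab, negbTE bc, negbTE ac) ?orbT.
Qed.

Lemma cycle_edges4 (T : finType) (a b c d : T) : uniq [:: a; b; c; d] ->
  cycle_edges [:: a; b; c; d] =
  [set [set a; b]; [set b; c]; [set c; d]; [set d; a]].
Proof.
rewrite /= !inE !negb_or andbT => /and3P[/and3P[ab ac ad] /andP[bc bd] cd].
have [ba ca da] : [/\ (b == a) = false, (c == a) = false & (d == a) = false].
  by rewrite ![_ == a]eq_sym !(negbTE ab, negbTE ac, negbTE ad).
have [cb db dc] : [/\ (c == b) = false, (d == b) = false & (d == c) = false].
  by rewrite ![_ == b]eq_sym [d == c]eq_sym !(negbTE bc, negbTE bd, negbTE cd).
apply/setP => e; apply/imsetP/idP.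
- case=> x; rewrite !inE => /or4P[] /eqP -> ->;
    by rewrite /= ?(eqxx, ba, ca, cb, da, db, dc, negbTE ab, negbTE bc,
         negbTE ac, negbTE ad, negbTE bd, negbTE cd) ?orbT.
- rewrite !inE -!orbA => /or4P[] /eqP ->; [exists a|exists b|exists c|exists d];
    by rewrite ?inE /= ?(eqxx, ba, ca, cb, da, db, dc, negbTE ab, negbTE bc,
         negbTE ac, negbTE ad, negbTE bd, negbTE cd) ?orbT.
Qed.

Lemma edgesP (T : finType) (g : rel T) (e : {set T}) :
  reflect (exists x y, g x y /\ e = [set x; y]) (e \in edges g).
Proof.
rewrite inE; apply: (iffP existsP) => [[x /existsP[y /andP[gxy /eqP ->]]]|].
  by exists x, y.
by case=> x [y [gxy ->]]; exists x; apply/existsP; exists y; rewrite gxy eqxx.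
Qed.

(** Common form of (P2), with [k = 3] in [g], and (P3), with [k = 4] in the complement. *)
Definition edge_in_unique_cycle (T : finType) (g : rel T) (k : nat) : Prop :=
  forall e : {set T}, e \in edges g ->
  exists! C : {set {set T}}, is_cycle g k C /\ e \in C.

(** * Unique triangles and quadrilaterals, restated for vertices *)

Section Triangles.

Context (T : finType) (g : rel T).
Context (g_sym : symmetric g) (g_irr : irreflexive g).

Lemma edge_neq x y : g x y -> x != y.
Proof. by apply: contraTneq => ->; rewrite g_irr. Qed.

Lemma triangle_uniq x y z : g x y -> g y z -> g z x -> uniq [:: x; y; z].
Proof.
move=> xy yz zx; rewrite /= !inE negb_or (edge_neq xy) (edge_neq yz).
by rewrite eq_sym (edge_neq zx).
Qed.

Lemma is_triangle3 x y z : g x y -> g y z -> g z x ->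
  is_triangle g (cycle_edges [:: x; y; z]).
Proof.
move=> xy yz zx; exists [:: x; y; z]; split => //.
by rewrite /ucycle (triangle_uniq xy yz zx) /= xy yz zx.
Qed.

Lemma common_neighbour : edge_in_unique_cycle g 3 ->
  forall x y, g x y -> exists z, g x z /\ g y z.
Proof.
move=> P2 x y xy.
have [|D [[[c [sc uc ->]] xyD] _]] := P2 [set x; y].
  by apply/edgesP; exists x, y.
case: c sc uc xyD => [|p [|q [|r [|]]]] //= _ /andP[/= /and4P[pq qr rp _] u].
(* Whichever edge of the triangle [xy] is, the vertex opposite to it is the witness. *)
rewrite cycle_edges3 // !inE -orbA => /or3P[] /eqP /eq_set2P[] [-> ->];
  by [exists r; rewrite ?(g_sym p r)  ?qr ?rp // g_sym
     |exists p; rewrite ?(g_sym q p)  ?pq ?rp // g_sym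
     |exists q; rewrite ?(g_sym r q)  ?pq ?qr // g_sym].
Qed.

(** The triangles [xyz] and [xyw] have the same edge set, so [yw] is an edge of [xyz]; this forces
    [w = z]. *)
Lemma common_neighbour_uniq : edge_in_unique_cycle g 3 ->
  forall x y z w, g x y -> g x z -> g y z -> g x w -> g y w -> z = w.
Proof.
move=> P2 x y z w xy xz yz xw yw.
have [|D [_ DU]] := P2 [set x; y]; first by apply/edgesP; exists x, y.
have zx : g z x by rewrite g_sym.
have wx : g w x by rewrite g_sym.
have uz := triangle_uniq xy yz zx.
have uw := triangle_uniq xy yw wx.
have Dz : D = cycle_edges [:: x; y; z].
  apply: DU; split; first exact: is_triangle3.
  by rewrite cycle_edges3 // !inE eqxx.
have Dw : D = cycle_edges [:: x; y; w].
  apply: DU; split; first exact: is_triangle3.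
  by rewrite cycle_edges3 // !inE eqxx.
have : [set y; w] \in D by rewrite Dw cycle_edges3 // !inE eqxx orbT.
have := edge_neq xy; have := edge_neq wx; have := edge_neq yw.
rewrite Dz cycle_edges3 // !inE -orbA => /eqP ? /eqP ? /eqP ?.
by case/or3P => /eqP /eq_set2P[] []; congruence.
Qed.

Lemma quadrilateral_uniq x y z w : g x y -> g y z -> g z w -> g w x ->
  x != z -> y != w -> uniq [:: x; y; z; w].
Proof.
move=> xy yz zw wx xz yw; rewrite /= !inE !negb_or.
rewrite (edge_neq xy) (edge_neq yz) (edge_neq zw) xz yw.
by rewrite eq_sym (edge_neq wx).
Qed.

Lemma edge_in_quadrilateral : edge_in_unique_cycle g 4 ->
  forall x y, g x y ->
  exists z w, [/\ g y z, g z w, g w x, x != z & y != w].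
Proof.
move=> P3 x y xy.
have [|D [[[c [sc uc ->]] xyD] _]] := P3 [set x; y].
  by apply/edgesP; exists x, y.
case: c sc uc xyD => [|p [|q [|r [|s [|]]]]] //= _.
case/andP => /= /and5P[pq qr rs sp _] u.
rewrite cycle_edges4 //.
move: u; rewrite /= !inE !negb_or andbT => /and3P[/and3P[_ pr _] /andP[_ qs] _].
(* Four positions of [xy] on the cycle, each in two orientations; the witnesses are the remaining
   vertices, read onwards from [y]. *)
rewrite -!orbA => /or4P[] /eqP /eq_set2P[] [-> ->];
  [exists r, s|exists s, r|exists s, p|exists p, s
  |exists p, q|exists q, p|exists q, r|exists r, q];
  split; first [done | by rewrite g_sym | by rewrite eq_sym].
Qed.

(** Both cycles have the same edge set, and in the first one the only edges other than [xy] at [y]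
    and at [x] are [yz] and [wx]. *)
Lemma edge_in_quadrilateral_uniq : edge_in_unique_cycle g 4 ->
  forall x y z w z' w', g x y ->
  g y z -> g z w -> g w x -> x != z -> y != w ->
  g y z' -> g z' w' -> g w' x -> x != z' -> y != w' -> z = z' /\ w = w'.
Proof.
move=> P3 x y z w z' w' xy yz zw wx xz yw yz' zw' wx' xz' yw'.
have [|D [_ DU]] := P3 [set x; y]; first by apply/edgesP; exists x, y.
have u := quadrilateral_uniq xy yz zw wx xz yw.
have u' := quadrilateral_uniq xy yz' zw' wx' xz' yw'.
have Dz : D = cycle_edges [:: x; y; z; w].
  apply: DU; rewrite {2}cycle_edges4 // !inE eqxx; split => //.
  by exists [:: x; y; z; w]; split; rewrite // /ucycle u /= xy yz zw wx.
have Dz' : D = cycle_edges [:: x; y; z'; w'].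
  apply: DU; rewrite {2}cycle_edges4 // !inE eqxx; split => //.
  by exists [:: x; y; z'; w']; split; rewrite // /ucycle u' /= xy yz' zw' wx'.
have : [set y; z'] \in D by rewrite Dz' cycle_edges4 // !inE eqxx ?orbT.
have : [set w'; x] \in D by rewrite Dz' cycle_edges4 // !inE eqxx ?orbT.
move: (edge_neq xy) (edge_neq yz) (edge_neq wx) (edge_neq yz') (edge_neq wx').
move: xz yw xz' yw'.
rewrite Dz cycle_edges4 // !inE -!orbA.
do 9 (move=> /eqP ?).
by case/or4P => /eqP /eq_set2P[] [? ?]; case/or4P => /eqP /eq_set2P[] [? ?];
  split; congruence.
Qed.

End Triangles.

(** * Configurations excluded by uniqueness in the complement *)

Section Structure.

Context (V : finType) (g : rel V).
Context (g_sym : symmetric g) (g_irr : irreflexive g).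
Context (P2 : edge_in_unique_cycle g 3).
Context (P3 : edge_in_unique_cycle (graph_compl g) 4).

Lemma graph_complE x y : graph_compl g x y = (x != y) && ~~ g x y.
Proof. by []. Qed.

Lemma compl_sym : symmetric (graph_compl g).
Proof. by move=> x y; rewrite !graph_complE eq_sym g_sym. Qed.

Lemma compl_irr : irreflexive (graph_compl g).
Proof. by move=> x; rewrite graph_complE eqxx. Qed.

Lemma compl_quadrilateral_uniq x y z w z' w' :
  uniq [:: x; y; z; w] -> uniq [:: x; y; z'; w'] ->
  ~~ g x y -> ~~ g y z -> ~~ g z w -> ~~ g w x ->
  ~~ g y z' -> ~~ g z' w' -> ~~ g w' x -> z = z' /\ w = w'.
Proof.
rewrite /= !inE !negb_or !andbT.
move=> /and3P[/and3P[xy xz xw] /andP[yz yw] zw].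
move=> /and3P[/and3P[_ xz' xw'] /andP[yz' yw'] zw'].
move=> nxy nyz nzw nwx nyz' nzw' nwx'.
have wx : w != x by rewrite eq_sym.
have wx' : w' != x by rewrite eq_sym.
by apply: (edge_in_quadrilateral_uniq compl_irr P3 (x := x) (y := y));
  rewrite // graph_complE; apply/andP.
Qed.

(** The quadrilaterals [x p y q] and [x p y r] of the complement would share the non-edge [xp]. *)
Lemma no_compl_K23 x y p q r : x != y -> uniq [:: p; q; r] ->
  (forall z, z \in [:: p; q; r] -> [/\ z != x, z != y, ~~ g x z & ~~ g y z]) ->
  False.
Proof.
rewrite /= !inE !negb_or !andbT => xy /andP[/andP[pq pr] qr] K.
have [px py nxp nyp] := K p (mem_head _ _).
have [|qx qy nxq nyq] := K q; first by rewrite !inE eqxx orbT.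
have [|rx ry nxr nyr] := K r; first by rewrite !inE eqxx !orbT.
have [||||||||| _ E] := @compl_quadrilateral_uniq x p y q y r;
  rewrite /= ?inE ?negb_or ?xy ?pq ?pr ?py ?[x == _]eq_sym ?[y == _]eq_sym
     ?px ?qx ?qy ?rx ?ry ?nxp ?nxq ?nxr ?nyp ?nyq ?nyr // 1?g_sym //.
by rewrite E eqxx in qr.
Qed.

(** Without edges the complement would be complete, and next to a quadrilateral [x y z w] through
    [xy] there would be a second one, [x y w z]. *)
Lemma exists_edge : 1 < #|V| -> exists x y, g x y.
Proof.
case/card_gt1P => x [y [_ _ xy]].
have [/existsP[u /existsP[v uv]]|N] := boolP [exists u, exists v, g u v].
  by exists u, v.
have ng u v : ~~ g u v.
  by apply: contra N => uv; apply/existsP; exists u; apply/existsP; exists v.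
have hxy : graph_compl g x y by rewrite graph_complE xy ng.
have [z [w [/andP[yz _] /andP[zw _] /andP[wx _] xz yw]]] :=
  edge_in_quadrilateral compl_sym P3 hxy.
have xw : x != w by rewrite eq_sym.
have wz : w != z by rewrite eq_sym.
have [|||||||||E _] := @compl_quadrilateral_uniq x y z w w z;
  rewrite ?ng //= ?inE ?negb_or ?xy ?xz ?yz ?yw ?zw ?xw ?wz //.
by rewrite E eqxx in zw.
Qed.

(** * Neighbours of the vertices of a triangle *)

Section AroundTriangle.

Context (a b c : V).
Context (ab : g a b) (bc : g b c) (ca : g c a).

(** Otherwise [x] would form a second triangle on [ab] or on [ca]. *)
Lemma adj_one_vertex x : g a x -> x != b -> x != c -> ~~ g b x /\ ~~ g c x.
Proof.
move=> ax xb xc; split; apply/negP => h.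
- move/eqP: xc; apply.
  by apply: (common_neighbour_uniq g_sym g_irr P2 ab); rewrite // g_sym.
- move/eqP: xb; apply.
  apply: (common_neighbour_uniq g_sym g_irr P2 ca) => //.
  by rewrite g_sym.
Qed.

(** The partner is the third vertex of the triangle on [ax]; it is neither [b] nor [c], as these are
    not adjacent to [x]. *)
Lemma adj_partner x : g a x -> x != b -> x != c ->
  exists y, [/\ g a y, g x y, y != b & y != c].
Proof.
move=> ax xb xc; have [y [ay xy]] := common_neighbour g_sym P2 ax.
have [nb nc] := adj_one_vertex ax xb xc.
exists y; split => //; apply: contraTneq xy => ->; by rewrite g_sym.
Qed.

End AroundTriangle.

(** An extra neighbour [x], its partner and [r] would be three common non-neighbours of [b] and
    [c]. *)
Lemma no_extra_neighbour_if_undominated a b c r x : g a b -> g b c -> g c a ->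
  r \notin [:: a; b; c] -> ~~ g a r -> ~~ g b r -> ~~ g c r ->
  g a x -> x \in [:: b; c].
Proof.
move=> ab bc ca; rewrite !inE !negb_or => /and3P[ra rb rc] nar nbr ncr ax.
apply/negPn/negP; rewrite negb_or => /andP[xb xc].
have [y [ay xy yb yc]] := adj_partner ab bc ca ax xb xc.
have [nbx ncx] := adj_one_vertex ab bc ca ax xb xc.
have [nby ncy] := adj_one_vertex ab bc ca ay yb yc.
have xr : x != r by apply: contraNneq nar => <-.
have yr : y != r by apply: contraNneq nar => <-.
apply: (@no_compl_K23 b c x y r) => [||z].
- exact: edge_neq bc.
- by rewrite /= !inE negb_or (edge_neq g_irr xy) xr yr.
- by rewrite !inE => /or3P[] /eqP ->.
Qed.

Lemma triangle_dominates a b c r : g a b -> g b c -> g c a ->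
  r \notin [:: a; b; c] -> [|| g a r, g b r | g c r].
Proof.
move=> ab bc ca r_out; apply/negPn/negP; rewrite !negb_or.
case/and3P => nar nbr ncr.
have r_out' : r \notin [:: b; c; a].
  by move: r_out; rewrite !inE !negb_or => /and3P[-> -> ->].
have r_out'' : r \notin [:: c; a; b].
  by move: r_out; rewrite !inE !negb_or => /and3P[-> -> ->].
have Na x := no_extra_neighbour_if_undominated (x := x)
  ab bc ca r_out nar nbr ncr.
have Nb x := no_extra_neighbour_if_undominated (x := x)
  bc ca ab r_out' nbr ncr nar.
have Nc x := no_extra_neighbour_if_undominated (x := x)
  ca ab bc r_out'' ncr nar nbr.
have har : graph_compl g a r.
  rewrite graph_complE nar andbT eq_sym.
  by move: r_out; rewrite !inE !negb_or => /and3P[].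
(* The quadrilateral [a r s w] supplies a second undominated vertex [w]: it is not adjacent to [a],
   and all neighbours of [b] and [c] lie in the triangle. *)
have [s [w [_ _ wa _ rw]]] := edge_in_quadrilateral compl_sym P3 har.
move: wa; rewrite graph_complE g_sym => /andP[wa naw].
have wb : w != b by apply: contraNneq naw => ->.
have wc : w != c by apply: contraNneq naw => ->; rewrite g_sym.
have nbw : ~~ g b w.
  by apply/negP => /Nb; rewrite !inE (negbTE wa) (negbTE wc).
have ncw : ~~ g c w.
  by apply/negP => /Nc; rewrite !inE (negbTE wa) (negbTE wb).
apply: (@no_compl_K23 r w a b c) => // [|z].
  exact: triangle_uniq.
move: r_out; rewrite !inE !negb_or => /and3P[ra rb rc].
by case/or3P => /eqP ->; rewrite ![_ == r]eq_sym ![_ == w]eq_sym ![g r _]g_sym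
  ![g w _]g_sym.
Qed.

(** Otherwise the edge [pq] would lie in the two triangles [upq] and [vpq]. *)
Lemma partners_not_both u v p q :
  g u p -> g u q -> g p q -> v != u -> ~~ g v p \/ ~~ g v q.
Proof.
move=> up uq pq vu; apply/orP; rewrite -negb_and; apply/negP => /andP[vp vq].
move/eqP: vu; apply.
by apply: (common_neighbour_uniq g_sym g_irr P2 pq); rewrite g_sym.
Qed.

(** The proof splits on whether [c] also has a neighbour outside the triangle; either way some
    non-edge lies on two quadrilaterals of the complement. *)
Lemma extra_neighbours_at_most_one_vertex a b c x y :
  g a b -> g b c -> g c a -> g a x -> x \notin [:: b; c] -> g b y -> y \notin [:: a; c] -> False.
Proof.
move=> ab bc ca ax; rewrite !inE !negb_or => /andP[xb xc] yB /andP[ya yc].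
have ba : g b a by rewrite g_sym.
have cb : g c b by rewrite g_sym.
have ac : g a c by rewrite g_sym.
have [x' [ax' xx' x'b x'c]] := adj_partner ab bc ca ax xb xc.
have [y' [yB' yy' y'a y'c]] := adj_partner ba ac cb yB ya yc.
have A1 := adj_one_vertex ab bc ca.
have B1 := adj_one_vertex ba ac cb.
have C1 := adj_one_vertex ca ab bc.
have [nbx ncx] := A1 x ax xb xc.
have [nbx' ncx'] := A1 x' ax' x'b x'c.
have [nay ncy] := B1 y yB ya yc.
have [nay' ncy'] := B1 y' yB' y'a y'c.
have sep_neq u p q : g u p -> ~~ g u q -> p != q.
  by move=> + n; apply: contraTneq => ->.
have ny' := edge_neq g_irr yy'.
have [/existsP[z /and3P[cz za zb]]|noC] :=
  boolP [exists z, [&& g c z, z != a & z != b]].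
  (* The non-edge [a y] lies on [a y c y'] and on [a y x0 z0]. *)
  have [z' [cz' zz' z'a z'b]] := adj_partner ca ab bc cz za zb.
  (* At most one end of the edge [xx'] is adjacent to [y], so the other can serve as [x0]; [z0] is
     chosen on [zz'] against [x0] in the same way. *)
  have [x0 [ax0 x0b x0c nx0y]] : exists x0,
      [/\ g a x0, x0 != b, x0 != c & ~~ g y x0].
    by case: (partners_not_both ax ax' xx' ya) => n; [exists x|exists x'].
  have [nbx0 ncx0] := A1 x0 ax0 x0b x0c.
  have [z0 [cz0 z0a z0b nz0x]] : exists z0,
      [/\ g c z0, z0 != a, z0 != b & ~~ g x0 z0].
    by case: (partners_not_both cz cz' zz' x0c) => n; [exists z|exists z'].
  have [naz0 nbz0] := C1 z0 cz0 z0a z0b.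
  have [||||||||| E _] := @compl_quadrilateral_uniq a y c y' x0 z0;
    rewrite // 1?g_sym //.
  - rewrite /= !inE !negb_or eq_sym ya (edge_neq g_irr ac) eq_sym y'a yc ny'.
    by rewrite eq_sym y'c.
  - rewrite /= !inE !negb_or eq_sym ya (edge_neq g_irr ax0) eq_sym z0a.
    rewrite eq_sym (sep_neq a) // (sep_neq b) // eq_sym (sep_neq c) //.
  - by rewrite E eqxx in x0c.
(* Without further vertices at [c] there are no edges between the two sides,
   so the non-edge [x y] lies on [x y x' y'] and on [x y x' c]. *)
have sep p q : g a p -> p != b -> p != c -> g b q -> q != a -> q != c ->
    ~~ g p q.
  move=> ap pb pc bq qa qc; apply/negP => pq.
  have [nbp ncp] := A1 p ap pb pc; have [naq ncq] := B1 q bq qa qc.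
  (* The third vertex [z] of the triangle on [pq] lies outside [abc], so it is dominated: by [a] or
     [b], which gives a second triangle on [pz] or [qz], or by [c], against [noC]. *)
  have [z [pz qz]] := common_neighbour g_sym P2 pq.
  have za : z != a by apply: contraNneq naq => <-; rewrite g_sym.
  have zb : z != b by apply: contraNneq nbp => <-; rewrite g_sym.
  have zc : z != c by apply: contraNneq ncp => <-; rewrite g_sym.
  have := @triangle_dominates a b c z ab bc ca.
  rewrite !inE !negb_or za zb zc => /(_ isT) /or3P[az|bz|cz].
  - move/eqP: qa; apply.
    by apply: (common_neighbour_uniq g_sym g_irr P2 pz); rewrite // g_sym.
  - move/eqP: pb; apply.
    by apply: (common_neighbour_uniq g_sym g_irr P2 qz); rewrite // g_sym.
  - move/existsP: noC; apply; exists z; by rewrite cz za zb.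
have nxy := sep x y ax xb xc yB ya yc.
have nx'y := sep x' y ax' x'b x'c yB ya yc.
have nx'y' := sep x' y' ax' x'b x'c yB' y'a y'c.
have nxy' := sep x y' ax xb xc yB' y'a y'c.
have [||||||||| _ E] := @compl_quadrilateral_uniq x y x' y' x' c;
  rewrite // 1?g_sym //.
- rewrite /= !inE !negb_or (edge_neq g_irr xx') ny' !(sep_neq a x) //.
  by rewrite eq_sym !(sep_neq a x').
- rewrite /= !inE !negb_or (edge_neq g_irr xx') yc xc x'c (sep_neq a) //.
  by rewrite eq_sym (sep_neq a).
- by rewrite E eqxx in y'c.
Qed.

(** * Identification of the graph *)

Lemma cover_triangle a b c : g a b -> g b c -> g c a ->
  cover (cycle_edges [:: a; b; c]) = [set a; b; c].
Proof.
move=> ab bc ca; rewrite cycle_edges3; last exact: triangle_uniq.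
rewrite /cover !bigcup_setU !big_set1; apply/setP => v; rewrite !inE.
by do 3 case: (v == _).
Qed.

Lemma edges_triangle_sub a b c : g a b -> g b c -> g c a ->
  cycle_edges [:: a; b; c] \subset edges g.
Proof.
move=> ab bc ca; rewrite cycle_edges3; last exact: triangle_uniq.
apply/subsetP => e; rewrite !in_setU !in_set1 -orbA.
by case/or3P => /eqP ->; apply/edgesP;
  [exists a, b|exists b, c|exists c, a].
Qed.

Lemma card_uniq_cover (s : seq V) :
  uniq s -> (forall v, v \in s) -> #|V| = size s.
Proof.
by move=> /card_uniqP <- cov; apply: eq_card => v; rewrite cov.
Qed.

(** By domination [a] is adjacent to every other vertex. Either it has no neighbour besides [b] and
    [c], or one such neighbour and its partner exhaust the rest. *)
Lemma triangles_at_vertex a b c : g a b -> g b c -> g c a ->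
  (forall y, g b y -> y \in [:: c; a]) ->
  (forall y, g c y -> y \in [:: a; b]) ->
  (#|V| = 5 \/ #|V| = 3) /\
  (is_triangle_graph g \/ is_two_triangles_at_vertex g).
Proof.
move=> ab bc ca Nb Nc.
have uabc := triangle_uniq g_irr ab bc ca.
have adj_a v : v \notin [:: a; b; c] -> g a v.
  move=> v_out; have /or3P[//|/Nb|/Nc] := triangle_dominates ab bc ca v_out;
  by rewrite !inE => /orP[] /eqP E; rewrite E !inE eqxx ?orbT in v_out.
have [/existsP[x /andP[ax]]|noA] :=
    boolP [exists x, g a x && (x \notin [:: b; c])].
  rewrite !inE negb_or => /andP[xb xc].
  have [y [ay xy yb yc]] := adj_partner ab bc ca ax xb xc.
  have [nbx ncx] := adj_one_vertex ab bc ca ax xb xc.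
  have [nby ncy] := adj_one_vertex ab bc ca ay yb yc.
  have ya : g y a by rewrite g_sym.
  have xNy := edge_neq g_irr xy.
  have aNx := edge_neq g_irr ax; have aNy := edge_neq g_irr ay.
  have uall : uniq [:: a; b; c; x; y].
    move: uabc; rewrite /= !inE !negb_or aNx aNy xNy ![_ == x]eq_sym.
    by rewrite ![_ == y]eq_sym xb xc yb yc !andbT.
  have cov v : v \in [:: a; b; c; x; y].
    have [/mem_subseq|v_out] := boolP (v \in [:: a; b; c]).
      by move=> H; apply: H; rewrite /= !eqxx.
    have av := adj_a v v_out; move: v_out.
    rewrite !inE !negb_or => /and3P[va vb vc].
    have [nbv ncv] := adj_one_vertex ab bc ca av vb vc.
    (* A sixth vertex [v] would join [x] and [y] as common non-neighbours of [b] and [c]. *)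
    apply/negPn/negP; rewrite !negb_or => /and5P[_ _ _ vx vy].
    apply: (@no_compl_K23 b c x y v) => [||z].
    - exact: edge_neq bc.
    - by rewrite /= !inE negb_or xNy ![_ == v]eq_sym vx vy.
    - by rewrite !inE => /or3P[] /eqP ->.
  split; first by left; rewrite (card_uniq_cover uall cov).
  right; exists (cycle_edges [:: a; b; c]), (cycle_edges [:: a; x; y]).
  split; try exact: is_triangle3.
  - apply/eqP; rewrite eqEsubset subUset !edges_triangle_sub // !andbT.
    apply/subsetP => e /edgesP[p [q [pq ->]]].
    rewrite !cycle_edges3 //; last exact: triangle_uniq.
    have [nxb nxc nyb nyc] : [/\ ~~ g x b, ~~ g x c, ~~ g y b & ~~ g y c].
      by rewrite ![g x _]g_sym ![g y _]g_sym.
    have noedge := (g_irr, negbTE nbx, negbTE ncx, negbTE nby, negbTE ncy,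
                    negbTE nxb, negbTE nxc, negbTE nyb, negbTE nyc).
    (* All 25 pairs are checked: [noedge] discards the non-edges, and [setUC] reverses an edge
       listed in the other orientation. *)
    have := cov p; have := cov q; rewrite !in_cons !in_nil !orbF.
    by do 4?[case/orP]; move=> /eqP Eq; do 4?[case/orP]; move=> /eqP Ep;
      move: pq; rewrite Ep Eq ?noedge // => _; rewrite !in_setU !in_set1;
      rewrite ?eqxx ?orbT // setUC ?eqxx ?orbT.
  - rewrite !cover_triangle //; apply/setP => v; have := cov v.
    by rewrite !inE -!orbA; do 5 case: (v == _).
  - exists a; rewrite !cover_triangle //; apply/setP => v; rewrite !inE.
    case: (v =P a) => //= _; case: (v =P b) => [->|_] /=.
      by rewrite ![b == _]eq_sym (negbTE xb) (negbTE yb).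
    by case: (v =P c) => //= ->; rewrite ![c == _]eq_sym (negbTE xc) (negbTE yc).
have cov v : v \in [:: a; b; c].
  apply/negPn/negP => v_out; move/existsP: noA; apply; exists v.
  rewrite adj_a //; move: v_out; rewrite !inE !negb_or.
  by case/and3P => _ -> ->.
split; first by right; rewrite (card_uniq_cover uabc cov).
left; exists (cycle_edges [:: a; b; c]); split; first exact: is_triangle3.
- apply/eqP; rewrite eqEsubset edges_triangle_sub // andbT.
  apply/subsetP => e /edgesP[p [q [pq ->]]].
  rewrite cycle_edges3 //.
  have := cov p; have := cov q; rewrite !in_cons !in_nil !orbF.
  by do 2?[case/orP]; move=> /eqP Eq; do 2?[case/orP]; move=> /eqP Ep;
    move: pq; rewrite Ep Eq ?g_irr // => _; rewrite !in_setU !in_set1;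
    rewrite ?eqxx ?orbT // setUC ?eqxx ?orbT.
- by rewrite cover_triangle //; apply/setP => v; have := cov v; rewrite !inE -orbA.
Qed.

End Structure.

Theorem theorem1 (V : finType) (g : rel V)
  (g_sym : symmetric g) (g_irr : irreflexive g)
  (V_gt1 : 1 < #|V|)
  (P2 : forall e : {set V}, e \in edges g ->
        exists! D : {set {set V}}, is_triangle g D /\ e \in D)
  (P3 : forall e : {set V}, e \in edges (graph_compl g) ->
        exists! Q : {set {set V}}, is_quadrilateral (graph_compl g) Q /\ e \in Q) :
  (#|V| = 5 \/ #|V| = 3) /\
  (is_triangle_graph g \/ is_two_triangles_at_vertex g).
Proof.
have [a [b ab]] := exists_edge g_sym P3 V_gt1.
have [c [ac bc]] := common_neighbour g_sym P2 ab.
have ca : g c a by rewrite g_sym.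
have excl u v w : g u v -> g v w -> g w u ->
    (exists2 x, g u x & x \notin [:: v; w]) ->
    forall y, g v y -> y \in [:: w; u].
  move=> uv vw wu [x ux x_out] y vy; apply/negPn/negP => y_out.
  apply: (extra_neighbours_at_most_one_vertex g_sym g_irr P2 P3 uv vw wu ux
    x_out vy).
  by move: y_out; rewrite !inE orbC.
have extra u v w : (exists2 x, g u x & x \notin [:: v; w]) \/
    (forall y, g u y -> y \in [:: v; w]).
  have [/existsP[x /andP[ux xo]]|N] :=
    boolP [exists x, g u x && (x \notin [:: v; w])]; first by left; exists x.
  right=> y uy; apply/negPn/negP => yo.
  by move/existsP: N; apply; exists y; rewrite uy.
have final u v w := @triangles_at_vertex V g g_sym g_irr P2 P3 u v w.
(* The vertex playing [a] in [final] is one with extra neighbours: [b] if it has any, else [c] if it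
   has any, else [a]. *)
case: (extra b c a) => [Xb|Nb].
  have Nc := excl b c a bc ca ab Xb.
  apply: (final b c a) => //.
  case: (extra a b c) => // Xa.
  case: Xb => x bx; by rewrite (excl a b c).
case: (extra c a b) => [Xc|Nc]; last exact: (final a b c).
by apply: (final c a b) => //; exact: excl Xc.
Qed.
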